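(* Let $L$ be a complete and completely distributive lattice that is upper well ordered, let $G$ be a group with identity $e$, and let $\mu\in L(G)$. If $\eta$ is a pronormal $L$-subgroup of $\mu$, then $\eta_t$ is a pronormal subgroup of $\mu_t$ for all $t\in L$ with $t\le\eta(e)$.
   Context: $L$ has least element $0$ and greatest element $1$. A lattice $L$ is upper well ordered if every non-empty subset of $L$ contains its supremum. An $L$-subset of $G$ is a function $G \to L$; inclusion $\eta\subseteq\mu$ means $\eta(x)\le\mu(x)$ for all $x\in G$; unions and intersections of $L$-subsets are pointwise joins and meets. For an $L$-subset $\mu$ and $t\in L$, the level subset is $\mu_t=\{x\in G:\mu(x)\ge t\}$. An $L$-subgroup of $G$ is a function $\mu: G\to L$ with $\mu(xy)\ge\mu(x)\wedge\mu(y)$ and $\mu(x^{-1})=\mu(x)$ for all $x,y\in G$; $L(G)$ is the set of these. For $\mu\in L(G)$, $L(\mu)$ denotes the set of $\eta\in L(G)$ with $\eta\subseteq\mu$ (the $L$-subgroups of $\mu$). For an $L$-subset $\theta$ of $G$, $\langle\theta\rangle$ is the smallest $L$-subgroup of $G$ containing $\theta$, and $\langle\eta,\nu\rangle=\langle\eta\cup\nu\rangle$. $L$-points: for $a\in L$, $x\in G$, the $L$-point $a_x$ is the $L$-subset with value $a$ at $x$ and $0$ elsewhere; $a_x\in\mu$ means $\mu(x)\ge a$. Conjugate: for $\eta\in L(\mu)$ and $a_z\in\mu$, $\eta^{a_z}$ is the $L$-subgroup of $\mu$ given by $\eta^{a_z}(x)=a\wedge\eta(zxz^{-1})$ for all $x\in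 G$. Pronormal $L$-subgroup: $\eta\in L(\mu)$ is a pronormal $L$-subgroup of $\mu$ if for every $L$-point $a_x\in\mu$ there exists an $L$-point $b_y\in\langle\eta,\eta^{a_x}\rangle$ such that $\eta^{b_y}=\eta^{a_x}$. Pronormal subgroup (classical): a subgroup $H$ of a group $K$ is pronormal in $K$ if for every $x\in K$ there is $y\in\langle H,H^x\rangle$ with $H^y=H^x$, where $H^x=xHx^{-1}$. *)

(* Defs.v *)
From mathcomp Require Import all_boot all_order boolp classical_sets.

Set Implicit Arguments.
Unset Strict Implicit.
Unset Printing Implicit Defensive.

Import Order.TTheory.
Local Open Scope classical_set_scope.
Local Open Scope group_scope.
Local Open Scope order_scope.

Section Lattice.
Context {d : Order.disp_t} (L : tbLatticeType d).

Definition complete_lattice : Prop :=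
  forall A : set L, supremums A !=set0 /\ infimums A !=set0.

(* [f] ranges over the choice functions of the family [J].  The default values
   \bot and \top make [supremum] and [infimum] correct on the empty set. *)
Definition completely_distributive : Prop :=
  forall (I : Type) (J : I -> set L),
    infimum (T := L) \top (range (fun i => supremum (T := L) \bot (J i))) =
    supremum (T := L) \bot
      [set infimum (T := L) \top (range f) | f in [set f : I -> L | forall i, J i (f i)]].

Definition upper_well_ordered : Prop :=
  forall A : set L, A !=set0 -> exists2 s, supremums A s & A s.

End Lattice.

Section Subgroup.
Context {G : groupType}.
Implicit Types H K : set G.

Definition subgroup H : Prop :=
  [/\ H 1%g, forall x y, H x -> H y -> H (x * y)%g & forall x, H x -> H x^-1%g].

Definition conj_set H (x : G) : set G := [set (x * h * x^-1)%g | h in H].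

Definition pronormal_subgroup H K : Prop :=
  [/\ subgroup H, subgroup K, H `<=` K &
      forall x, K x ->
        exists2 y, smallest subgroup (H `|` conj_set H x)%classic y &
                   conj_set H y = conj_set H x].

End Subgroup.

Section LSubgroup.
Context {d : Order.disp_t} {L : tbLatticeType d} {G : groupType}.
Implicit Types eta mu nu theta : G -> L.

Definition Lsub eta mu : Prop := forall x, eta x <= mu x.

Definition Lunion eta nu : G -> L := fun x => eta x `|` nu x.

Definition level mu (t : L) : set G := [set x | t <= mu x].

Definition Lsubgroup mu : Prop :=
  (forall x y, mu x `&` mu y <= mu (x * y)%g) /\ (forall x, mu x^-1%g = mu x).

Definition Lsubgroup_of mu eta : Prop := Lsubgroup eta /\ Lsub eta mu.

(* Pointwise meet of all the L-subgroups containing theta; see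
   [Lgenerated_smallest]. *)
Definition Lgenerated theta : G -> L :=
  fun x => infimum \top [set nu x | nu in [set nu | Lsubgroup nu /\ Lsub theta nu]].

Lemma Lgenerated_smallest theta : complete_lattice L ->
  [/\ Lsubgroup (Lgenerated theta), Lsub theta (Lgenerated theta) &
      forall nu, Lsubgroup nu -> Lsub theta nu -> Lsub (Lgenerated theta) nu].
Proof.
move=> Lc.
have infP (A : set L) : infimums A (infimum \top A).
  rewrite /infimum; case: ifP => [/eqP ->|_].
    by split=> [|y _]; [move=> ? | exact: lex1].
  by case: xgetP => [y -> //|no_inf]; have [_ [y /no_inf]] := Lc A.
have glb x a : (forall nu, Lsubgroup nu -> Lsub theta nu -> a <= nu x) ->
    a <= Lgenerated theta x.
  by move=> le_a; apply: (infP _).2 => _ [nu [? ?] <-]; exact: le_a.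
have lb nu : Lsubgroup nu -> Lsub theta nu -> Lsub (Lgenerated theta) nu.
  by move=> ? ? x; apply: (infP _).1; exists nu.
split=> //; last by move=> x; apply: glb => nu _; exact.
have lbV x : Lgenerated theta x <= Lgenerated theta x^-1%g.
  by apply: glb => nu nuG th_nu; rewrite nuG.2; exact: lb.
split=> [x y|x]; last by apply/le_anti; rewrite lbV andbT -{2}[x]invgK lbV.
apply: glb => nu nuG th_nu; apply: le_trans (nuG.1 x y).
by apply: leI2; exact: lb.
Qed.

(* The L-point a_x is represented by the pair (a, x): all the notions below
   depend on it only through a and x. *)
Definition Lpoint_in (a : L) (x : G) mu : Prop := a <= mu x.

Definition Lconj eta (a : L) (z : G) : G -> L :=
  fun x => a `&` eta (z * x * z^-1)%g.

Definition pronormal_Lsubgroup eta mu : Prop :=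
  Lsubgroup_of mu eta /\
  forall (a : L) (x : G), Lpoint_in a x mu ->
    exists (b : L) (y : G),
      Lpoint_in b y (Lgenerated (Lunion eta (Lconj eta a x))) /\
      Lconj eta b y = Lconj eta a x.

End LSubgroup.

(* Main.v *)
(* An upper well ordered lattice is a chain in which the elements below a
   non-minimal t have a largest one m < t.  Hence, if K is the subgroup generated
   by the t-level of theta, the L-subgroup equal to \top on K and to m off K
   contains theta, which shows that the t-level of the L-subgroup generated by
   theta lies in K.  For x in mu_t, pronormality of eta at the L-point t_{x^-1}
   gives some b_y; evaluating eta^{b_y} = eta^{t_{x^-1}} at e yields t <= b, and
   the t-levels of these conjugates show that y^-1 conjugates eta_t like x. *)
Require Import Defs.
From mathcomp Require Import all_boot all_order boolp classical_sets.

Import Order.TTheory.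
Local Open Scope classical_set_scope.
Local Open Scope order_scope.

Section UpperWellOrdered.
Context {d : Order.disp_t} {L : tbLatticeType d} (L_uwo : upper_well_ordered L).

(** The pair {a, b} contains its supremum, which is therefore the larger of the two. *)
Lemma upper_well_ordered_total (a b : L) : (a <= b) || (b <= a).
Proof.
have [s [s_ub _] s_ab] := L_uwo [set a; b] (ex_intro _ a (or_introl erefl)).
have as_ : a <= s by apply: s_ub; left.
have bs : b <= s by apply: s_ub; right.
by case: s_ab => sE; rewrite sE in as_ bs; rewrite ?as_ ?bs ?orbT.
Qed.

Lemma upper_well_ordered_ltNge (a b : L) : (a < b) = ~~ (b <= a).
Proof.
apply/idP/idP => [/lt_geF -> //|nba]; rewrite lt_leAnge nba andbT.
by have := upper_well_ordered_total a b; rewrite (negbTE nba) orbF.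
Qed.

(** In a chain a join is one of its arguments; hence the level of a union of L-subsets is the union
    of their levels. *)
Lemma upper_well_ordered_lexU (t a b : L) :
  (t <= a `|` b) = (t <= a) || (t <= b).
Proof.
apply/idP/orP => [|[] /le_trans-> //]; [|exact: leUl|exact: leUr].
by case/orP: (upper_well_ordered_total a b) => [/join_r|/join_l] ->;
  [right|left].
Qed.

End UpperWellOrdered.

Section Subgroups.
Context {G : groupType}.
Implicit Types (A H : set G) (x y : G).

Lemma smallest_subgroup A : subgroup (smallest subgroup A).
Proof.
split=> [B [[]//]|x y xA yA B BA|x xA B BA].
  by have [_ BM _] := BA.1; apply: BM; [exact: xA|exact: yA].
by have [_ _ BV] := BA.1; apply: BV; exact: xA.
Qed.

Lemma conj_setP H x y : conj_set H x y <-> H (x^-1 * y * x)%g.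
Proof.
split=> [[h Hh <-]|Hy]; first by rewrite !mulgA mulVg mul1g mulgVK.
by exists (x^-1 * y * x)%g => //; rewrite !mulgA mulgV mul1g mulgK.
Qed.

End Subgroups.

Section Levels.
Context {d : Order.disp_t} {L : tbLatticeType d} {G : groupType}.
Implicit Types (mu eta theta : G -> L) (t a b : L) (x y : G).

Lemma level_subgroup mu t :
  Lsubgroup mu -> t <= mu 1%g -> subgroup (level mu t).
Proof.
move=> [muM muV] t1; split=> // [x y tx ty|x tx]; last by rewrite /level /= muV.
by apply: le_trans (muM x y); rewrite lexI; apply/andP; split.
Qed.

(** The meet with [a] is invisible at levels below [a]. The inverse appears because [Lconj]
    evaluates [eta] at x y x^-1, whereas [conj_set] takes the image under that map. *)
Lemma level_Lconj eta t a x : t <= a ->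
  level (Lconj eta a x) t = conj_set (level eta t) x^-1%g.
Proof.
move=> ta; by apply/seteqP; split=> y;
  rewrite conj_setP invgK /level /Lconj /= lexI ta.
Qed.

(** If a product lies off [K], so does one of its factors, and the meet of the two values is then at
    most [m]. *)
Lemma Lsubgroup_two_valued (K : set G) (m : L) :
  subgroup K -> Lsubgroup (fun x => if `[< K x >] then \top else m).
Proof.
move=> [_ KM KV]; split=> [x y|x]; last first.
  have KVE : K x^-1%g = K x.
    by apply/propext; split=> /KV //; rewrite invgK.
  by rewrite KVE.
case: (asboolP (K (x * y)%g)) => [_|nKxy]; first exact: lex1.
case: (asboolP (K x)) => [Kx|_]; last exact: leIl.
by case: (asboolP (K y)) => [Ky|_]; [case: nKxy; exact: KM|exact: leIr].
Qed.

Lemma level_Lgenerated theta t :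
  complete_lattice L -> upper_well_ordered L ->
  level (Lgenerated theta) t `<=` smallest subgroup (level theta t).
Proof.
move=> Lc Lu y ty; set K := smallest _ _.
have lt_off x : ~ K x -> theta x < t.
  move=> nKx; rewrite (upper_well_ordered_ltNge Lu); apply/negP => tx.
  by apply: nKx; apply: sub_gen_smallest.
apply: contrapT => nKy.
(* The point [y] off [K] makes this set non-empty, so its supremum [m] belongs to it and is still
   strictly below [t]. *)
have [m [m_ub _] mt] := Lu [set s | s < t] (ex_intro _ (theta y) (lt_off y nKy)).
have [_ _ gen_min] := Lgenerated_smallest theta Lc.
have theta_le : Lsub theta (fun x => if `[< K x >] then \top else m).
  move=> x; case: asboolP => [_|nKx]; first exact: lex1.
  by apply: m_ub; exact: lt_off.
have := gen_min _ (Lsubgroup_two_valued _ m (smallest_subgroup _)) theta_le y.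
by rewrite asboolF // => /(le_trans ty); rewrite (lt_geF mt).
Qed.

End Levels.

Theorem theorem3p8 (d : Order.disp_t) (L : tbLatticeType d)
    (L_complete : complete_lattice L)
    (L_cdistr : completely_distributive L)
    (L_uwo : upper_well_ordered L)
    (G : groupType) (mu eta : G -> L)
    (mu_Lsubgroup : Lsubgroup mu)
    (eta_pronormal : pronormal_Lsubgroup eta mu) :
  forall t : L, t <= eta 1%g -> pronormal_subgroup (level eta t) (level mu t).
Proof.
move=> t t1; have [[eta_sub eta_mu] pron] := eta_pronormal.
split; [exact: level_subgroup|
        by apply: level_subgroup => //; exact: le_trans (eta_mu _)|
        by move=> x tx; exact: le_trans (eta_mu x)|].
move=> x tx.
have tx' : Lpoint_in t x^-1%g mu by rewrite /Lpoint_in mu_Lsubgroup.2.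
have [b [y [b_y conjE]]] := pron t x^-1%g tx'.
have tb : t <= b.
  (* At the identity the right side is [t] met with [eta 1], which is [t]; the left side is at most
     [b]. *)
  have := congr1 (fun f => f 1%g) conjE.
  by rewrite /Lconj !mulg1 !mulgV (meet_l t1) => <-; exact: leIl.
(* Inverted like [x] above, to pass from [Lconj] to [conj_set]; a subgroup containing [y] contains
   this witness. *)
exists y^-1%g.
  have [_ _ SV] := smallest_subgroup (level eta t `|` conj_set (level eta t) x)%classic.
  apply: SV.
  have <- : level (Lunion eta (Lconj eta t x^-1%g)) t =
      (level eta t `|` conj_set (level eta t) x)%classic.
    rewrite -{2}[x]invgK -(level_Lconj eta t t) //.
    by apply/seteqP; split=> z;
      rewrite /level /Lunion /= upper_well_ordered_lexU // => /orP.
  by apply: level_Lgenerated => //; exact: le_trans b_y.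
by rewrite -(level_Lconj eta t b) // conjE (level_Lconj eta t t) // invgK.
Qed.
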